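(* Let $r\ge3$ be an odd integer and let $a=r+1$. The subtraction game $\mathcal{S}(1,a,a+r)=\mathcal{S}(1,a,2a-1)$ is periodic with period $2a$ and nim-sequence $(01)^{a/2}\,2\,(01)^{(a-2)/2}\,2$. Moreover, the subtraction set is non-expandable.
   Context: For a finite set $S$ of positive integers, the subtraction game $\mathcal{S}(S)$ is played on a single pile: two players alternately remove $s\in S$ coins (at most the pile size); the last mover wins. The nim-value is $\mathcal{G}(n)=\operatorname{mex}\{\mathcal{G}(n-s): s\in S, s\le n\}$. Words of single digits are written by juxtaposition, and $x^m$ denotes $m$-fold repetition of the block $x$. ''The game is periodic with period $p$ and nim-sequence $W$'' ($W$ a word of length $p$) means $\mathcal{G}(n+p)=\mathcal{G}(n)$ for all $n\ge0$, $p$ is the least such, and $\mathcal{G}(n)$ is the $((n\bmod p)+1)$-st letter of $W$ for all $n\ge0$. The expansion of $S$ is $S^{ex}=\{s\ge1:\mathcal{G}(n+s)\ne\mathcal{G}(n)\ \forall n\ge0\}$. For a set $X$ and $p\ge1$, $X^{*p}=\{x+mp:x\in X,m\ge0\}$. $S$ is non-expandable if $S^{ex}=S$ or $S^{ex}=S^{*p}$, $p$ the period of the game. *)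

(* Defs.v *)
From mathcomp Require Import all_boot.
From mathcomp Require Import finmap.
From mathcomp Require Import classical_sets.

Set Implicit Arguments.
Unset Strict Implicit.
Unset Printing Implicit Defensive.

Local Open Scope classical_set_scope.
Local Open Scope nat_scope.

Definition mex (X : seq nat) : nat :=
  find (fun k => k \notin X) (iota 0 (size X).+1).

Lemma mexP (X : seq nat) :
  mex X \notin X /\ (forall k, k < mex X -> k \in X).
Proof.
have hasX : has (fun k => k \notin X) (iota 0 (size X).+1).
  apply/negPn/negP => /hasPn XP.
  have sub : {subset iota 0 (size X).+1 <= X} by move=> k /XP; rewrite negbK.
  by have := uniq_leq_size (iota_uniq _ _) sub; rewrite size_iota ltnn.
have ltm : mex X < (size X).+1 by move: hasX; rewrite has_find size_iota.
split; first by have := nth_find 0 hasX; rewrite nth_iota.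
move=> k ltk; have := before_find 0 ltk.
by rewrite nth_iota ?(ltn_trans ltk) // => /negbFE.
Qed.

(* nim_values S n = [:: G 0; ...; G (n - 1)] for the subtraction game on S.   *)
Fixpoint nim_values (S : {fset nat}) (n : nat) : seq nat :=
  if n is m.+1 then
    let h := nim_values S m in
    rcons h (mex [seq nth 0 h (m - s) | s <- S & s <= m])
  else [::].

(* Only meaningful when 0 is not in S; nim_valueE is the defining recursion.  *)
Definition nim_value (S : {fset nat}) (n : nat) : nat :=
  last 0 (nim_values S n.+1).

Lemma size_nim_values (S : {fset nat}) n : size (nim_values S n) = n.
Proof. by elim: n => //= n IHn; rewrite size_rcons IHn. Qed.

Lemma nth_nim_values (S : {fset nat}) n k :
  k < n -> nth 0 (nim_values S n) k = nim_value S k.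
Proof.
elim: n => // n IHn; rewrite ltnS leq_eqVlt => /orP[/eqP-> | ltkn].
  by rewrite /nim_value /= last_rcons nth_rcons size_nim_values ltnn eqxx.
by rewrite /= nth_rcons size_nim_values ltkn IHn.
Qed.

Lemma nim_valueE (S : {fset nat}) n : 0 \notin S ->
  nim_value S n = mex [seq nim_value S (n - s) | s <- S & s <= n].
Proof.
move=> S0; rewrite {1}/nim_value /= last_rcons; congr mex.
apply/eq_in_map => s; rewrite mem_filter => /andP[lesn sS].
have s_gt0 : 0 < s by rewrite lt0n; apply: contraNneq S0 => <-.
by rewrite nth_nim_values // ltn_subrL s_gt0 (leq_trans s_gt0).
Qed.

Definition has_period (S : {fset nat}) (p : nat) : Prop :=
  0 < p /\ forall n, nim_value S (n + p) = nim_value S n.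

Definition least_period (S : {fset nat}) (p : nat) : Prop :=
  has_period S p /\ forall q, has_period S q -> p <= q.

Definition periodic_with (S : {fset nat}) (p : nat) (W : seq nat) : Prop :=
  [/\ least_period S p, size W = p
    & forall n, nim_value S n = nth 0 W (n %% p)].

Definition expansion (S : {fset nat}) : set nat :=
  [set s | 1 <= s /\ forall n, nim_value S (n + s) <> nim_value S n].

Definition periodic_extension (X : set nat) (p : nat) : set nat :=
  [set y | exists x m, X x /\ y = x + m * p].

Definition non_expandable (S : {fset nat}) : Prop :=
  expansion S = [set` S] \/
  exists p, least_period S p /\ expansion S = periodic_extension [set` S] p.

(* x^m for a word x. *)
Definition word_pow (x : seq nat) (m : nat) : seq nat := flatten (nseq m x).

(* Main.v *)
Require Import Defs.
From mathcomp Require Import all_boot.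
From mathcomp Require Import finmap.
From mathcomp Require Import classical_sets zify.

Local Open Scope fset_scope.
Local Open Scope nat_scope.

(** Let W be the word and [p = 2a].  Since [2a - 1] is [-1] modulo [p], the
options of [n] lie in the residue classes of [n - 1], [n + 1] and [n + a], so
that [G n = W (n mod p)] is a finite check on residues.  In a period the letter
2 occurs exactly at [a] and [2a - 1]; these positions split the period into
arcs of lengths [a - 1] and [a + 1], so no smaller shift is a period.  The
expansion contains S by the mex rule and is closed under adding [p]; any other
residue [s] has a repeated 0 at distance [s], between positions [0] and [s],
[p - s] and [p], or [a - 2] and [a - 2 + s]. *)

Lemma mex_eq (X : seq nat) v :
  v \notin X -> (forall k, k < v -> k \in X) -> mex X = v.
Proof.
move=> vX ltX; have [mX ltmX] := mexP X.
by case: (ltngtP (mex X) v) => // [/ltX | /ltmX] H; rewrite H in mX vX.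
Qed.

(** The two hypotheses on [f] are the two halves of the mex rule; [0 \notin S] makes every option
    smaller, so strong induction applies. *)
Lemma nim_value_unique (S : {fset nat}) (f : nat -> nat) : 0 \notin S ->
  (forall n s, s \in S -> s <= n -> f (n - s) <> f n) ->
  (forall n k, k < f n -> exists s, [/\ s \in S, s <= n & f (n - s) = k]) ->
  nim_value S =1 f.
Proof.
move=> S0 fneq fex n; elim/ltn_ind: n => n IHn.
have GE s : s \in S -> s <= n -> nim_value S (n - s) = f (n - s).
  move=> sS sn; apply: IHn; have : s != 0 by apply: contraNneq S0 => <-.
  by lia.
rewrite nim_valueE //; apply: mex_eq => [|k /fex[s [sS sn fk]]].
  apply/mapP => -[s]; rewrite mem_filter => /andP[sn sS] fE.
  by apply: (fneq n s sS sn); rewrite -GE.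
by apply/mapP; exists s; rewrite ?mem_filter ?sS ?sn // GE.
Qed.

(** [n] is an option of [n + s], and a mex avoids the values of all options. *)
Lemma nim_value_neq (S : {fset nat}) n s : 0 \notin S -> s \in S ->
  nim_value S (n + s) <> nim_value S n.
Proof.
move=> S0 sS E; have [+ _] := mexP
  [seq nim_value S (n + s - t) | t <- S & t <= n + s].
rewrite -nim_valueE // E => /mapP[]; exists s; last by rewrite addnK.
by rewrite mem_filter leq_addl.
Qed.

Lemma word_pow01 m i : i < 2 * m -> nth 0 (word_pow [:: 0; 1] m) i = odd i.
Proof.
elim: m i => [|m IHm] [|[|i]] // im.
by rewrite /= negbK -IHm //; lia.
Qed.

Lemma size_word_pow x m : size (word_pow x m) = m * size x.
Proof. by elim: m => //= m IHm; rewrite size_cat IHm mulSn. Qed.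

(** Closed form of the word: the 2 inserted at the even position [a] delays the alternation by one,
    so parity is flipped beyond it. *)
Definition letter (a i : nat) : nat :=
  if (i == a) || (i == 2 * a - 1) then 2 else odd i (+) (a < i).

Lemma nth_word a i : ~~ odd a -> 1 < a -> i < 2 * a ->
  nth 0 (word_pow [:: 0; 1] (a %/ 2) ++ [:: 2] ++
         word_pow [:: 0; 1] ((a - 2) %/ 2) ++ [:: 2]) i = letter a i.
Proof.
move=> a_even a_gt1 i_lt; rewrite /letter.
rewrite nth_cat size_word_pow /=; case: ifP => i1.
  by rewrite word_pow01; [case: ifP|]; lia.
case di: (i - a %/ 2 * 2) => [|j] /=; first by case: ifP; lia.
rewrite nth_cat size_word_pow /=; case: ifP => j1.
  by rewrite word_pow01; [case: ifP|]; lia.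
have -> : j - (a - 2) %/ 2 * 2 = 0 by lia.
by move=> /=; case: ifP; lia.
Qed.

Lemma modn_unique q p i n : n = q * p + i -> i < p -> n %% p = i.
Proof. by move=> -> ip; rewrite modnMDl modn_small. Qed.

Section Game.

Variable a : nat.
Hypotheses (a_even : ~~ odd a) (a_gt3 : 3 < a).

Let S := [fset 1; a; 2 * a - 1].
Let p := 2 * a.

Lemma mem_moves s : s \in S = [|| s == 1, s == a | s == p - 1].
Proof. by rewrite !inE orbA. Qed.

Lemma moves_gt0 : 0 \notin S.
Proof. by rewrite mem_moves; lia. Qed.

Lemma letter_lt i : i < a -> letter a i = odd i.
Proof.
move=> ia; have ip : i < 2 * a - 1 by lia.
by rewrite /letter !ltn_eqF // ltnNge ltnW // addbF.
Qed.

Lemma letter_gt i : a < i -> i < p - 1 -> letter a i = ~~ odd i.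
Proof. by move=> ai ip; rewrite /letter gtn_eqF // ltn_eqF // ai addbT. Qed.

Lemma letter_mid : letter a a = 2.
Proof. by rewrite /letter eqxx. Qed.

Lemma letter_last : letter a (p - 1) = 2.
Proof. by rewrite /letter eqxx orbT. Qed.

Lemma letter_eq2 i : (letter a i == 2) = (i == a) || (i == p - 1).
Proof. by rewrite /letter; case: ifP => // _; case: (_ (+) _). Qed.

Lemma letterS i : i.+1 < p -> letter a i <> letter a i.+1.
Proof.
move=> ip; case: (ltngtP i.+1 a) => [ia|ai|iE].
- by rewrite !letter_lt //= 1?ltnW //; case: (odd i).
- have [iE|i_neq] := eqVneq i.+1 (p - 1).
    by rewrite iE letter_last letter_gt; [case: (odd i) | lia | lia].
  rewrite [letter a i.+1]letter_gt //=; last by lia.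
  have [->|i_neqa] := eqVneq i a; first by rewrite letter_mid; case: (odd a).
  by rewrite letter_gt ?negbK; [case: (odd i) | lia | lia].
- by rewrite iE letter_mid letter_lt -?iE //; case: (odd i).
Qed.

(** As [a] is even, [i] and [i + a] have equal parity, but the alternation is reversed beyond [a];
    at both ends of the range a 2 faces a 0 or 1. *)
Lemma letterD i : i < a -> letter a (i + a) <> letter a i.
Proof.
move=> ia; rewrite [letter a i]letter_lt //.
case: (posnP i) => [->|i_gt0]; first by rewrite letter_mid.
have [iE|i_neq] := eqVneq (i + a) (p - 1).
  by rewrite iE letter_last; case: (odd i).
rewrite letter_gt; [|lia|lia].
by rewrite oddD (negbTE a_even) addbF; case: (odd i).
Qed.

Lemma letter0 : letter a 0 = 0.
Proof. by rewrite letter_lt //; lia. Qed.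

(** A 1 never follows a 2: position [a + 1] carries 0, and [p - 1] ends the period. *)
Lemma letter_pred i : i < p -> letter a i = 1 -> 0 < i /\ letter a i.-1 = 0.
Proof.
case: i => [|i] ip; first by rewrite letter0.
move=> /= i1; split=> //; have := letterS _ ip; rewrite i1.
have : letter a i != 2; last first.
  by rewrite /letter; case: ifP => // _; case: (_ (+) _).
rewrite letter_eq2; apply/norP; split; last by lia.
apply: contra_eqN i1 => /eqP->.
by rewrite letter_gt ?ltnS //= ?negbK ?(negbTE a_even) //; lia.
Qed.

Lemma nim_value_letter n : nim_value S n = letter a (n %% p).
Proof.
move: n; apply: nim_value_unique moves_gt0 _ _ => n; last first.
- move=> k; have nE := divn_eq n p.
  have : n %% p < p by rewrite ltn_pmod //; lia.
  move: (n %/ p) (n %% p) nE => q i nE ip.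
  (* Smaller values are all found within the period of [n], so the move used is automatically
     legal. *)
  have reach s j : s \in S -> n = q * p + (j + s) -> j < p -> letter a j = k ->
      exists t, [/\ t \in S, t <= n & letter a ((n - t) %% p) = k].
    move=> sS; rewrite addnA => e jp <-; exists s.
    split=> //; first by rewrite e leq_addl.
    by rewrite e addnK modnMDl modn_small.
  have in1 : 1 \in S by rewrite mem_moves.
  case: (eqVneq (letter a i) 2) => [/eqP | i_neq2 ki].
    rewrite letter_eq2 => /orP[] /eqP iE.
      rewrite iE letter_mid; case: k reach => [|[|//]] reach _.
        by apply: (reach a 0 _ _ _ letter0);
          [rewrite mem_moves eqxx orbT | rewrite nE iE | lia].
      apply: (reach 1 a.-1 in1);
        [by rewrite nE iE addn1 prednK //; lia | lia |].
      by rewrite letter_lt ?odd_pred ?(negbTE a_even) //; lia.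
    rewrite iE letter_last; case: k reach => [|[|//]] reach _.
      by apply: (reach (p - 1) 0 _ _ _ letter0);
        [rewrite mem_moves eqxx !orbT | rewrite nE iE | lia].
    apply: (reach 1 (p - 2) in1); [by rewrite nE iE; congr addn; lia | lia |].
    by rewrite letter_gt ?oddB ?oddM //; lia.
  have [k0 i1] : k = 0 /\ letter a i = 1.
    move: ki i_neq2; rewrite /letter; case: ifP => // _.
    by case: (_ (+) _) => //; case: k {reach}.
  have [i_gt0 i1'] := letter_pred _ ip i1.
  apply: (reach 1 i.-1 in1); [by rewrite nE addn1 prednK | lia |].
  by rewrite i1' k0.
- move=> s; have nE := divn_eq n p.
  have : n %% p < p by rewrite ltn_pmod //; lia.
  move: (n %/ p) (n %% p) nE => q i nE ip; rewrite mem_moves => sS sn.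
  have shift d j : n = d * p + j + s -> j < p -> letter a j <> letter a i ->
      letter a ((n - s) %% p) <> letter a i.
    by move=> -> jp; rewrite addnK modnMDl modn_small.
  (* A legal move larger than the residue [i] forces [q > 0] and lands in the previous period. *)
  have borrow j : i < s -> i + p = j + s -> n = q.-1 * p + j + s.
    case: q nE => [|q] nE iS e; first by rewrite nE leqNgt iS in sn.
    by rewrite nE mulSn /= -[RHS]addnA -e addnAC [LHS]addnC [p + i]addnC.
  case/or3P: sS => /eqP sE; rewrite {}sE in sn shift borrow *.
  + case: (posnP i) => [i0|i_gt0].
      apply: (shift _ (p - 1) (borrow _ _ _)); [lia | lia | lia |].
      by rewrite i0 letter_last letter0.
    apply: (shift q i.-1); [by rewrite nE -addnA addn1 prednK | lia |].
    by have := @letterS i.-1; rewrite prednK //; apply.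
  + case: (ltnP i a) => ia.
      apply: (shift _ (i + a) (borrow _ _ _)); [lia | lia | lia |].
      exact: letterD.
    apply: (shift q (i - a)); [by rewrite nE -addnA subnK | lia |].
    by have := @letterD (i - a); rewrite subnK // => H; apply/nesym/H; lia.
  (* The move [p - 1] raises the residue by 1, wrapping from [p - 1] to 0. *)
  + case: (eqVneq i (p - 1)) => ip1.
      apply: (shift q 0); [by rewrite nE ip1 addn0 | lia |].
      by rewrite ip1 letter_last letter0.
    apply: (shift _ i.+1 (borrow _ _ _)); [lia | lia | lia |].
    by apply/nesym/letterS; lia.
Qed.

Lemma least_period_game : least_period S p.
Proof.
split=> [|q [q_gt0 qP]]; first split=> [|n]; first by lia.
  by rewrite !nim_value_letter modnDr.
rewrite leqNgt; apply/negP => qp.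
have two n : n < p -> letter a n == 2 -> letter a ((n + q) %% p) == 2.
  by move=> np; rewrite -nim_value_letter qP nim_value_letter modn_small.
have /two: a < p by lia.
have /two: p - 1 < p by lia.
rewrite !letter_eq2 !eqxx orbT => /(_ isT) H1 /(_ isT) H2.
(* [p - 1] is sent to a 2 only if [q = a + 1], but then [a] is sent to residue 1, which carries no
   2. *)
have E1 : (p - 1 + q) %% p = q.-1 by apply: (@modn_unique 1); lia.
case: (ltnP (a + q) p) => aq.
  by move: H1 H2; rewrite E1 modn_small //; lia.
have E2 : (a + q) %% p = a + q - p by apply: (@modn_unique 1); lia.
by move: H1 H2; rewrite E1 E2; lia.
Qed.

Lemma repeated_letter s : s < p -> s \notin S ->
  exists n, letter a ((n + s) %% p) = letter a (n %% p).
Proof.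
rewrite mem_moves => sp /norP[s_neq1 /norP[s_neqa s_neqp]].
have [s_odd|s_even] := boolP (odd s); case: (ltngtP s a) s_neqa => // sa _.
- have s_gt2 : 2 < s by case: s s_neq1 s_odd {s_neqp sp sa} => [|[|[|]]].
  (* Since [2 < s < a], position [a - 2 + s] lies strictly between the two 2s, where the flip
     compensates the odd distance. *)
  exists (a - 2); rewrite !modn_small; [|lia|lia].
  rewrite letter_gt ?letter_lt; [|lia|lia|lia].
  by rewrite oddD oddB 1?(negbTE a_even) ?s_odd //; lia.
- exists 0; rewrite mod0n add0n modn_small // letter0.
  by rewrite letter_gt ?s_odd //; lia.
(* This case includes [s = 0], the residue of the multiples of [p]. *)
- exists 0; rewrite mod0n add0n modn_small // letter0 letter_lt //.
  by rewrite (negbTE s_even).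
- exists (p - s); rewrite subnK 1?ltnW // modnn modn_small; last by lia.
  by rewrite letter0 letter_lt ?oddB ?oddM ?(negbTE s_even) // 1?ltnW //; lia.
Qed.

Lemma expansion_game :
  expansion S = periodic_extension [set` S]%classic p.
Proof.
have per m n : nim_value S (n + m * p) = nim_value S n.
  by rewrite !nim_value_letter addnC modnMDl.
apply/seteqP; split=> [s [s_gt0 sP]|_ [s [m [/= sS ->]]]]; last first.
  split; last by move=> n; rewrite addnA per; apply: nim_value_neq moves_gt0 _.
  by move: sS; rewrite mem_moves; lia.
exists (s %% p), (s %/ p); split; last by rewrite addnC -divn_eq.
(* Were the residue outside [S], a letter repeated at that distance would give equal nim-values at
   distance [s]. *)
apply/negPn/negP => /= sS.
have [|n nP] := repeated_letter _ _ sS; first by rewrite ltn_pmod //; lia.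
by apply: (sP n); rewrite !nim_value_letter -nP modnDmr.
Qed.

End Game.

Theorem theorem3p5 (r a : nat) (hr : 3 <= r) (hodd : odd r) (ha : a = r + 1) :
  [/\ [fset 1; a; a + r] = [fset 1; a; 2 * a - 1],
      periodic_with [fset 1; a; a + r] (2 * a)
        (word_pow [:: 0; 1] (a %/ 2) ++ [:: 2] ++
         word_pow [:: 0; 1] ((a - 2) %/ 2) ++ [:: 2])
    & non_expandable [fset 1; a; a + r]].
Proof.
have a_even : ~~ odd a by lia.
have a_gt3 : 3 < a by lia.
have -> : a + r = 2 * a - 1 by lia.
split=> //.
- split; first exact: least_period_game.
    by rewrite !(size_cat, size_word_pow) /=; lia.
  move=> n; rewrite nth_word ?nim_value_letter //; first by lia.
  by rewrite ltn_pmod //; lia.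
- right; exists (2 * a); split; first exact: least_period_game.
  exact: expansion_game.
Qed.
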